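(* Let $G$ be a cograph with every connected component of even order. Then $\chi_{\mathsf{odd}}(G) \leq 3$. Moreover, this bound is tight: there exists a cograph $G$ with every connected component of even order such that $\chi_{\mathsf{odd}}(G)=3$.
   Context: All graphs are finite, simple and undirected. A graph is called odd if every vertex has odd degree. $\chi_{\mathsf{odd}}(G)$, the odd chromatic number of $G$, is the minimum number of odd induced subgraphs of $G$ whose vertex sets partition $V(G)$. (By a theorem of Scott, such a partition exists if and only if every connected component of $G$ has even order.) A cograph is a graph with no induced path on four vertices. *)

(* Defs.v *)
From mathcomp Require Import all_boot.

Set Implicit Arguments.
Unset Strict Implicit.
Unset Printing Implicit Defensive.

Record sgraph := SGraph {
  vertex :> finType;
  adj : rel vertex;
  adj_sym : symmetric adj;
  adj_irrefl : irreflexive adj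
}.

Definition degree (G : sgraph) (v : G) : nat := #|[set w | adj v w]|.

Definition odd_graph (G : sgraph) : bool := [forall v : G, odd (degree v)].

Section Induced.

Variables (G : sgraph) (S : {set G}).

Definition induced_adj : rel {x : G | x \in S} :=
  fun x y => adj (val x) (val y).

Fact induced_adj_sym : symmetric induced_adj.
Proof. by move=> x y; apply: adj_sym. Qed.

Fact induced_adj_irrefl : irreflexive induced_adj.
Proof. by move=> x; apply: adj_irrefl. Qed.

Definition induced : sgraph := SGraph induced_adj_sym induced_adj_irrefl.

End Induced.

Section PathGraph.

Variable n : nat.

Definition path_adj : rel 'I_n := fun i j => (i.+1 == j) || (j.+1 == i).

Fact path_adj_sym : symmetric path_adj.
Proof. by move=> i j; rewrite /path_adj orbC. Qed.

Fact path_adj_irrefl : irreflexive path_adj.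
Proof. by move=> i; rewrite /path_adj orbb eqn_leq ltnn. Qed.

Definition path_graph : sgraph := SGraph path_adj_sym path_adj_irrefl.

End PathGraph.

Definition has_induced_copy (H G : sgraph) : Prop :=
  exists f : H -> G, injective f /\ forall x y : H, adj (f x) (f y) = adj x y.

Definition cograph (G : sgraph) : Prop := ~ has_induced_copy (path_graph 4) G.

Definition components (G : sgraph) : {set {set G}} :=
  equivalence_partition (connect (@adj G)) [set: G].

Definition even_components (G : sgraph) : Prop :=
  forall C : {set G}, C \in components G -> ~~ odd #|C|.

Definition odd_partition (G : sgraph) (P : {set {set G}}) : bool :=
  partition P [set: G] && [forall S in P, odd_graph (induced S)].

(* The odd chromatic number is a partial invariant: a graph with a component
   of odd order has no odd partition.  It is therefore given as a functional
   relation, so that "k is the odd chromatic number of G" includes the existence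
   of an odd partition and no default value is involved. *)
Definition is_odd_chromatic_number (G : sgraph) (k : nat) : Prop :=
  (exists2 P : {set {set G}}, odd_partition P & #|P| = k) /\
  (forall P : {set {set G}}, odd_partition P -> k <= #|P|).

Lemma odd_chromatic_number_unique (G : sgraph) (k l : nat) :
  is_odd_chromatic_number G k -> is_odd_chromatic_number G l -> k = l.
Proof.
move=> [[P oP <-] minP] [[Q oQ <-] minQ].
by apply/eqP; rewrite eqn_leq minP ?minQ.
Qed.

(* Main.v *)
(** Gallai: every graph splits into an even and an odd induced subgraph. If G is
the join of A and B with |A| and |B| odd, then the even parts of A and B have
odd order and the odd parts have even order, so joining the even parts gives an
odd graph, and so does joining the odd parts: two colours suffice. If |A| and
|B| are even, first give an edge ab its own colour; what remains is a join of
two sets of odd order. By Seinsche's theorem a cograph with at least two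
vertices is disconnected or a join, so induction gives three colours.
In the octahedron K_{2,2,2} two colours are impossible: if t_j is the parity of
the number of vertices of the first colour in the j-th part, then every i
requires t_j + t_k = 1 for the other two indices, and three bits cannot be
pairwise distinct. *)

Require Import Defs.
From mathcomp Require Import all_boot.

Set Implicit Arguments.
Unset Strict Implicit.
Unset Printing Implicit Defensive.

Local Notation "\xor_ ( i 'in' A ) F" := (\big[addb/false]_(i in A) F%B)
  (at level 41, F at level 41, i, A at level 50).

(** * Gallai's theorem modulo 2 and odd colourings of joins *)

Section Parity.

Variable T : finType.
Implicit Types (A B : {set T}) (e : rel T) (P Q s : pred T).

Lemma odd_card_xor A P : odd #|[set u in A | P u]| = \xor_(u in A) P u.
Proof.
rewrite -sum1_card (big_morph odd oddD (erefl : odd 0 = false)).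
rewrite (eq_bigl (fun u => (u \in A) && P u)) => [|u]; last by rewrite inE.
rewrite big_mkcondr; apply: eq_bigr => u _; by case: (P u).
Qed.

Lemma xor_split A P Q :
  \xor_(u in A) (P u (+) Q u) = (\xor_(u in A) P u) (+) (\xor_(u in A) Q u).
Proof. exact: big_split. Qed.

Lemma xor_setU1 A P x : x \notin A ->
  \xor_(u in x |: A) P u = P x (+) \xor_(u in A) P u.
Proof. exact: big_setU1. Qed.

Lemma xor_setD1 A P x : x \in A ->
  \xor_(u in A) P u = P x (+) \xor_(u in A :\ x) P u.
Proof. exact: big_setD1. Qed.

Lemma xor_setU A B P : [disjoint A & B] ->
  \xor_(u in A :|: B) P u = (\xor_(u in A) P u) (+) \xor_(u in B) P u.
Proof. by move=> dAB; rewrite -bigU //=; apply: eq_bigl => u; rewrite !inE. Qed.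

(** Each edge is counted from both ends: in the induction, the row and the column of the removed
    vertex [v] agree by symmetry and cancel. *)
Lemma xor_handshake e A : symmetric e -> irreflexive e ->
  \xor_(x in A) \xor_(u in A) e x u = false.
Proof.
move=> symE irrE; have [n] := ubnP #|A|; elim: n A => // n IHn A leAn.
have [->|[v vA]] := set_0Vmem A; first by rewrite big_set0.
have IH : \xor_(x in A :\ v) \xor_(u in A :\ v) e x u = false.
  by apply: IHn; move: leAn; rewrite (cardsD1 v A) vA.
rewrite (xor_setD1 _ vA) (xor_setD1 _ vA) irrE.
rewrite (eq_bigr _ (fun x _ => xor_setD1 (e x) vA)) xor_split IH addbF.
by rewrite (eq_bigr _ (fun x _ => symE x v)) addbb.
Qed.

(* [c] marks the neighbours of an additional vertex lying in the class [s = true];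
   for [c = xpredT] the other members of that class get odd degree. *)
Lemma gallai_weighted e (c : pred T) A : symmetric e ->
  exists s : pred T, {in A, forall x,
    \xor_(u in A :\ x) (e x u && (s u == s x)) = c x && s x}.
Proof.
have [n] := ubnP #|A|; elim: n e c A => // n IHn e c A leAn symE.
have [/forall_inP evenA|/forall_inPn[v vA oddv]] :=
  boolP [forall x in A, \xor_(u in A :\ x) e x u == c x].
  exists xpredT => x xA; rewrite andbT -(eqP (evenA x xA)).
  by apply: eq_bigr => u _; rewrite andbT.
(* Remove [v] and complement the graph inside its neighbourhood; [v] then goes
   to the class in which it has evenly many neighbours. *)
set A' := A :\ v in oddv.
pose e' x y := e x y (+) (e v x && e v y).
pose c' x := c x (+) (e v x && c v).
have leA'n : #|A'| < n by move: leAn; rewrite (cardsD1 v A) vA.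
have symE' : symmetric e' by move=> x y; rewrite /e' symE andbC.
have {IHn}[s Hs] := IHn e' c' A' leA'n symE'.
pose N a := \xor_(u in A') (e v u && (s u == a)).
have NE : N true (+) N false = ~~ c v.
  rewrite -xor_split (eq_bigr (e v)) => [|u _].
    by move: oddv; case: (\xor_(u in A') e v u) (c v) => [] [].
  by case: (e v u) (s u) => [] [].
pose b := N true == c v.
exists (fun u => if u == v then b else s u) => x.
have [-> _|neq_xv xA] := eqVneq x v.
  rewrite (eq_bigr (fun u => e v u && (s u == b))); last first.
    by move=> u; rewrite !inE => /andP[/negPf->].
  rewrite -/(N b) /b; move: NE; case: eqP => [->|]; last first.
    by rewrite andbF; case: (N true) (N false) (c v) => [] [] [].
  by rewrite andbT.
have xA' : x \in A' by rewrite !inE neq_xv.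
have vAx : v \in A :\ x by rewrite !inE eq_sym neq_xv.
have eqA : A :\ x :\ v = A' :\ x by apply/setP=> u; rewrite !inE andbCA.
rewrite (xor_setD1 _ vAx) eqxx eqA.
rewrite (eq_bigr (fun u => e x u && (s u == s x))); last first.
  by move=> u; rewrite !inE => /andP[_ /andP[/negPf->]].
have := xor_setD1 (fun u => e v u && (s u == s x)) xA'.
rewrite -/(N (s x)) eqxx andbT.
have := Hs x xA'; rewrite (eq_bigr (fun u => (e x u && (s u == s x)) (+)
  (e v x && (e v u && (s u == s x))))); last first.
  by move=> u _; rewrite /e'; case: (e x u) (e v x) (e v u) => [] [] [] //=; case: eqP.
rewrite xor_split -big_distrr /= (symE v x) /c' (symE v x) /b.
(* Only neighbours of [v] need an argument: there the toggled edges change the parity by the other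
   neighbours of [v] in the class of [x], and the choice of [b] compensates. What is left is a
   Boolean identity. *)
move: NE; case: (s x).
  move: (N true) (N false) (\xor_(u in _) (e x u && _)) (\xor_(u in _) (e v u && _)).
  by case: (c v) (c x) (e x v) => [] [] [] [] [] [] [].
move: (N true) (N false) (\xor_(u in _) (e x u && _)) (\xor_(u in _) (e v u && _)).
by case: (c v) (c x) (e x v) => [] [] [] [] [] [] [].
Qed.

(** The edges inside the two classes form a graph whose odd vertices are those with [s = true], so
    the handshake lemma makes their number even. *)
Lemma gallai_even_odd e A : symmetric e -> irreflexive e ->
  exists2 s : pred T,
    {in A, forall x, \xor_(u in A) (e x u && (s u == s x)) = s x} &
    \xor_(x in A) s x = false.
Proof.
move=> symE irrE; have [s Hs] := gallai_weighted xpredT A symE.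
have {}Hs : {in A, forall x, \xor_(u in A) (e x u && (s u == s x)) = s x}.
  by move=> x xA; rewrite (xor_setD1 _ xA) irrE Hs.
exists s => //; rewrite -(eq_bigr _ Hs); apply: xor_handshake => [x y|x].
  by rewrite symE eq_sym.
by rewrite irrE.
Qed.

(** Not a proper colouring: for a graph [e], each colour class within [A] induces an odd graph.
    Colours lie in any [eqType], so that predicates, ['I_3] and the block map of a partition all
    qualify. *)
Definition odd_coloring e A (C : eqType) (f : T -> C) : Prop :=
  {in A, forall x, \xor_(u in A) (e x u && (f u == f x))}.

(** No edge between [A] and [B] is monochromatic, so neither side disturbs the parities on the
    other. This serves both for absent edges and for disjoint palettes. *)
Lemma odd_coloringU e A B (C : eqType) (f : T -> C) :
  symmetric e -> [disjoint A & B] ->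
  {in A & B, forall x y, ~~ (e x y && (f y == f x))} ->
  odd_coloring e A f -> odd_coloring e B f -> odd_coloring e (A :|: B) f.
Proof.
move=> symE dAB noAB oddA oddB x; rewrite inE => /orP[] xAB; rewrite xor_setU //.
  rewrite [X in _ (+) X]big1 ?addbF ?oddA // => y yB.
  exact/negbTE/noAB.
rewrite [X in X (+) _]big1 ?oddB // => y yA.
by rewrite symE eq_sym; apply/negbTE/noAB.
Qed.

Lemma eq_odd_coloring e A (C C' : eqType) (f : T -> C) (g : T -> C') :
  {in A &, forall x y, (f x == f y) = (g x == g y)} ->
  odd_coloring e A f -> odd_coloring e A g.
Proof.
move=> eqfg oddf x xA; have := oddf x xA; congr is_true; apply: eq_bigr => u uA.
by rewrite eqfg.
Qed.

Lemma odd_join_coloring e A B : symmetric e -> irreflexive e ->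
  [disjoint A & B] -> {in A & B, forall x y, e x y} ->
  odd #|A| -> odd #|B| -> exists s : pred T, odd_coloring e (A :|: B) s.
Proof.
move=> symE irrE dAB joinAB oddA oddB.
have [sA HsA sA0] := gallai_even_odd A symE irrE.
have [sB HsB sB0] := gallai_even_odd B symE irrE.
(* Across the join a vertex of class [a] gains parity [~~ a], which complements its parity [a] on
   its own side, so the total is odd. *)
have cross (D : {set T}) (s : pred T) (a : bool) : odd #|D| -> \xor_(u in D) s u = false ->
    \xor_(u in D) (s u == a) = ~~ a.
  move=> oddD s0; rewrite (eq_bigr (fun u => s u (+) ~~ a)); last first.
    by move=> u _; case: (s u) a => [] [].
  rewrite (xor_split D s (fun=> ~~ a)) s0; case: a; first by rewrite big1_eq.
  rewrite -[RHS]oddD -(odd_card_xor D xpredT); congr odd.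
  by apply: eq_card => u; rewrite inE andbT.
have notB u : u \in A -> u \in B = false by move=> uA; rewrite (disjointFr dAB).
exists (fun u => if u \in B then sB u else sA u) => x.
rewrite inE xor_setU // => /orP[xA|xB].
  rewrite (notB x xA) (eq_bigr (fun u => e x u && (sA u == sA x))); last first.
    by move=> u uA; rewrite notB.
  rewrite [X in _ (+) X](eq_bigr (fun u => sB u == sA x)); last first.
    by move=> u uB; rewrite uB joinAB.
  by rewrite HsA // cross // addbN addbb.
rewrite xB (eq_bigr (fun u => sA u == sB x)); last first.
  by move=> u uA; rewrite notB // symE joinAB.
rewrite [X in _ (+) X](eq_bigr (fun u => e x u && (sB u == sB x))); last first.
  by move=> u uB; rewrite uB.
by rewrite HsB // cross // addNb addbb.
Qed.

Lemma join_coloring e A B : symmetric e -> irreflexive e ->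
  [disjoint A & B] -> {in A & B, forall x y, e x y} ->
  A != set0 -> B != set0 -> ~~ odd #|A :|: B| ->
  exists f : T -> 'I_3, odd_coloring e (A :|: B) f.
Proof.
move=> symE irrE dAB joinAB nA nB.
rewrite cardsU disjoint_setI0 // cards0 subn0 oddD.
(* Only colours 0 and 2 are used; colour 1 stays free for the edge [ab]. *)
have two (s : pred T) D : odd_coloring e D s ->
    odd_coloring e D (fun u => if s u then ord_max else ord0 : 'I_3).
  by apply: eq_odd_coloring => x y _ _; case: (s x) (s y) => [] [].
case oA: (odd #|A|); case oB: (odd #|B|) => // _.
  have [s /two Hs] := odd_join_coloring symE irrE dAB joinAB oA oB; by eexists; eauto.
have /set0Pn[a aA] := nA; have /set0Pn[b bB] := nB.
have [||||s /two Hs] := @odd_join_coloring e (A :\ a) (B :\ b) symE irrE.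
- by apply: disjointWl (disjointWr _ dAB); rewrite subD1set.
- by move=> x y; rewrite !inE => /andP[_ xA] /andP[_ yB]; apply: joinAB.
- by move: oA; rewrite (cardsD1 a) aA /=; case: odd.
- by move: oB; rewrite (cardsD1 b) bB /=; case: odd.
have neq_ab : a != b by apply: contraTneq bB => <-; rewrite (disjointFr dAB).
pose D := (A :\ a) :|: (B :\ b).
have eqD : A :|: B = [set a; b] :|: D.
  apply/setP=> x; rewrite !inE; case: eqVneq => [->|_] /=; first by rewrite aA.
  by case: eqVneq => [->|_] /=; rewrite ?bB ?orbT.
have notD x : x \in D -> x \in [set a; b] = false.
  move=> xD; apply/negP; rewrite !inE => /orP[]/eqP xE; move: xD.
    by rewrite xE !inE eqxx (disjointFr dAB) // andbF.
  by rewrite xE !inE eqxx (disjointFl dAB) // andbF.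
exists (fun u => if u \in [set a; b] then inord 1 else
   if s u then ord_max else ord0).
rewrite eqD; apply: odd_coloringU => //.
- by rewrite disjoint_sym disjoints_subset; apply/subsetP => x /notD xab; rewrite inE xab.
- move=> x y xab yD; rewrite xab (notD y yD) negb_and; apply/orP; right.
  by rewrite -val_eqE /= inordK //; case: ifP.
- apply: (@eq_odd_coloring _ _ _ _ (fun=> tt)) => [x y xab yab|x].
    by rewrite xab yab !eqxx.
  rewrite xor_setU1 ?inE // big_set1 !andbT => /orP[]/eqP->; rewrite irrE.
    by rewrite joinAB.
  by rewrite addbF symE joinAB.
apply: eq_odd_coloring Hs => x y xD yD /=; by rewrite (notD x xD) (notD y yD).
Qed.

End Parity.

(** * Seinsche's theorem on graphs without induced four-vertex paths *)

Section Seinsche.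

Variable T : finType.
Implicit Types (A B : {set T}) (e : rel T).

(** Applied to [rel_compl e], this says that [A] is the join of two non-empty sets. *)
Definition disconnected e A : Prop :=
  exists B C : {set T}, [/\ A = B :|: C, [disjoint B & C], B != set0, C != set0
    & {in B & C, forall x y, ~~ e x y}].

Definition P4_free e A : Prop :=
  forall a b c d, {subset [:: a; b; c; d] <= A} -> uniq [:: a; b; c; d] ->
  ~~ [&& e a b, e b c, e c d, ~~ e a c, ~~ e b d & ~~ e a d].

Definition rel_compl e : rel T := fun x y => ~~ e x y.

Lemma P4_free_subset e A B : A \subset B -> P4_free e B -> P4_free e A.
Proof.
by move=> /subsetP sAB P4B a b c d sA; apply: P4B => x /sA /sAB.
Qed.

(** The four-vertex path is self-complementary: the complement of the path [a b c d] is the path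
    [c a d b]. *)
Lemma P4_free_compl e A : symmetric e -> P4_free e A -> P4_free (rel_compl e) A.
Proof.
move=> symE P4A a b c d sA uA.
have := P4A c a d b; rewrite /rel_compl !negbK (symE c a) (symE d b) (symE c b).
have permA : perm_eq [:: c; a; d; b] [:: a; b; c; d].
  by apply/permP => p /=; rewrite !addn0; case: (p a) (p b) (p c) (p d) => [] [] [] [].
rewrite (perm_uniq permA) => P4'; apply/negP => /and5P[ab bc cd ac /andP[bd ad]].
apply: (negP (P4' _ uA)); last by rewrite ac ad bd cd ab bc.
by move=> x; rewrite (perm_mem permA); apply: sA.
Qed.

Lemma disjointsU1 A B x :
  [disjoint x |: A & B] = (x \notin B) && [disjoint A & B].
Proof. by rewrite -disjointU1; apply: eq_disjoint => y; rewrite !inE. Qed.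

Lemma disconnected_setD e A B : B \subset A -> B != set0 -> A :\: B != set0 ->
  {in B & A :\: B, forall x y, ~~ e x y} -> disconnected e A.
Proof.
move=> sBA nB nAB noE; exists B, (A :\: B); split=> //.
  by rewrite setUC -{1}(setID A B) (setIidPr sBA) setUC.
by rewrite disjoints_subset; apply/subsetP=> x xB; rewrite !inE xB.
Qed.

(** If [v] has no neighbour on one side, it joins the other side; if it is adjacent to all of [A],
    the result is a join. Otherwise its non-neighbours on one side are cut off from the rest, since
    an edge to a neighbour of [v] on that side would extend to an induced path through [v]. *)
Lemma disconnected_setU1 e A v : symmetric e -> v \notin A -> P4_free e (v |: A) ->
  disconnected e A ->
  disconnected e (v |: A) \/ disconnected (rel_compl e) (v |: A).
Proof.
move=> symE vA P4 [B [C [defA dBC nB nC noBC]]].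
have [/exists_inP[b bB vb]|/exists_inPn noB] := boolP [exists b in B, e v b]; last first.
  left; exists B, (v |: C); split=> //.
  - by rewrite defA setUCA.
  - move: vA; rewrite defA !inE negb_or => /andP[vB _].
    by rewrite disjoint_sym disjointsU1 vB disjoint_sym.
  - by apply/set0Pn; exists v; rewrite !inE eqxx.
  - move=> x y xB; rewrite !inE => /orP[/eqP->|]; last exact: noBC.
    by rewrite symE noB.
have [/exists_inP[c cC vc]|/exists_inPn noC] := boolP [exists c in C, e v c]; last first.
  left; exists C, (v |: B); split=> //.
  - by rewrite defA [B :|: C]setUC setUCA.
  - move: vA; rewrite defA !inE negb_or => /andP[_ vC].
    by rewrite disjoint_sym disjointsU1 vC.
  - by apply/set0Pn; exists v; rewrite !inE eqxx.
  - move=> x y xC; rewrite !inE symE => /orP[/eqP->|]; first exact: noC.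
    by move=> yB; apply: noBC.
have [/forall_inP allA|/forall_inPn[y yA vy]] := boolP [forall y in A, e v y].
  right; exists [set v], A; split=> //.
  - by rewrite disjoints1.
  - by apply/set0Pn; exists v; rewrite inE.
  - by apply/set0Pn; exists b; rewrite defA inE bB.
  - by move=> x y /set1P-> yA; rewrite /rel_compl negbK allA.
(* Both sides contain neighbours of [v], so they are interchangeable; [B] is taken to be the side of
   the non-neighbour [y]. *)
left; wlog yB : B C b c defA dBC nB nC noBC bB vb cC vc / y \in B.
  move=> wlogB; move: (yA); rewrite {1}defA inE => /orP[]; first exact: (wlogB B C b c).
  apply: (wlogB C B c b) => //; rewrite 1?setUC 1?disjoint_sym //.
  by move=> x z xC zB; rewrite symE noBC.
have sBA : B \subset A by rewrite defA subsetUl.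
(* Such an edge [xz] makes [x z v c] an induced path, as [c] lies in [C]. *)
have [/exists_inP[z /setIdP[zB vz] /exists_inP[x /setIdP[xB vx] xz]]|noxz] :=
  boolP [exists z in [set z in B | e v z], exists x in [set x in B | ~~ e v x], e x z].
  have neq_Bv u : u \in B -> u != v.
    by move=> uB; apply: contraNneq vA => <-; apply: (subsetP sBA).
  have cA : c \in A by rewrite defA inE cC orbT.
  have neq_Bc u : u \in B -> u != c.
    by move=> uB; apply: contraTneq cC => <-; rewrite (disjointFr dBC).
  case: (negP (P4 x z v c _ _)).
  - move=> u; rewrite !inE => /or4P[]/eqP->; rewrite ?eqxx ?cA ?orbT //.
      by rewrite (subsetP sBA) ?orbT.
    by rewrite (subsetP sBA) ?orbT.
  - rewrite /= !inE !negb_or (neq_Bv x xB) (neq_Bv z zB) (neq_Bc x xB) (neq_Bc z zB) !andbT; apply/andP; split.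
      by apply: contraNneq vx => ->.
    by apply: contraNneq vA => ->.
  - by rewrite xz (symE z v) vz vc (symE x v) vx !noBC.
apply: (@disconnected_setD e (v |: A) [set x in B | ~~ e v x]).
- by apply/subsetP=> x; rewrite !inE => /andP[xB _]; rewrite (subsetP sBA) // orbT.
- by apply/set0Pn; exists y; rewrite inE yB.
- by apply/set0Pn; exists c; rewrite !inE vc andbF /= defA inE cC !orbT.
move=> x z /setIdP[xB vx]; rewrite !inE negb_and negbK => /andP[zBv /predU1P[->|]].
  by rewrite symE.
rewrite {1}defA inE => /orP[zB|]; last exact: noBC.
move: zBv; rewrite zB /= => vz; apply: contraNN noxz => xz.
by apply/exists_inP; exists z; rewrite ?inE ?zB //; apply/exists_inP; exists x; rewrite ?inE ?xB.
Qed.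

(** Induction on the order by deleting a vertex [v]. The extension step is applied to [e] or to its
    complement, according to which of the two is disconnected on [A :\ v]. *)
Lemma P4_free_disconnected e A : symmetric e -> P4_free e A -> 1 < #|A| ->
  disconnected e A \/ disconnected (rel_compl e) A.
Proof.
move=> symE; have [n] := ubnP #|A|; elim: n A => // n IHn A leAn P4 A1.
have /set0Pn[v vA] : A != set0 by rewrite -card_gt0 ltnW.
have cA : #|A| = #|A :\ v|.+1 by rewrite (cardsD1 v) vA.
have symC : symmetric (rel_compl e) by move=> x y; rewrite /rel_compl symE.
have [Av1|] := ltnP 1 #|A :\ v|.
  have [|||dis|dis] := IHn (A :\ v).
  - by move: leAn; rewrite cA.
  - by apply: P4_free_subset P4; apply: subD1set.
  - by [].
  - have := @disconnected_setU1 e (A :\ v) v symE; rewrite setD1K // !inE eqxx.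
    exact.
  - have := @disconnected_setU1 (rel_compl e) (A :\ v) v symC.
    rewrite setD1K // !inE eqxx => /(_ isT (P4_free_compl symE P4) dis).
    case; [by right | move=> [B [C [? ? ? ? noE]]]; left].
    by exists B, C; split=> // x y xB yC; have := noE x y xB yC; rewrite /rel_compl negbK.
(* Base case [A = {v, w}]: the pair is a non-edge of [e] or of its complement. *)
rewrite leq_eqVlt ltnNge -ltnS -cA A1 orbF => /cards1P[w defAw].
have eqA : A = [set v] :|: [set w] by rewrite -defAw setD1K.
have /setD1P[neq_wv _] : w \in A :\ v by rewrite defAw inE.
have dis e' : ~~ e' v w -> disconnected e' A.
  move=> vw; exists [set v], [set w]; split=> //; first by rewrite disjoints1 inE eq_sym.
  - by apply/set0Pn; exists v; rewrite inE.
  - by apply/set0Pn; exists w; rewrite inE.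
  by move=> x y /set1P-> /set1P->.
by have [vw|vw] := boolP (e v w); [right | left]; apply: dis; rewrite /rel_compl ?vw.
Qed.

End Seinsche.

(** * Three colours for cographs; colourings versus partitions *)

Section Cographs.

(** The parity hypothesis expresses even components through separated parts. In this form it passes
    to both sides of a disconnection, since a part separated within one side is separated within
    [A]. *)
Lemma P4_free_odd_coloring (T : finType) (e : rel T) (A : {set T}) :
  symmetric e -> irreflexive e -> P4_free e A ->
  (forall B C, A = B :|: C -> [disjoint B & C] ->
     {in B & C, forall x y, ~~ e x y} -> ~~ odd #|B|) ->
  exists f : T -> 'I_3, odd_coloring e A f.
Proof.
move=> symE irrE; have [n] := ubnP #|A|; elim: n A => // n IHn A leAn P4 evenA.
have evA : ~~ odd #|A|.
  apply: (evenA _ set0); rewrite ?setU0 ?disjoints_subset ?setC0 ?subsetT //.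
  by move=> x y _; rewrite inE.
have [->|nA] := eqVneq A set0.
  by exists (fun=> ord0) => x; rewrite inE.
have A1 : 1 < #|A| by move: nA evA; rewrite -card_gt0; case: #|A| => [|[]].
have [] := P4_free_disconnected symE P4 A1 => -[B [C [defA dBC nB nC noBC]]].
  have cA : #|A| = #|B| + #|C| by rewrite defA cardsU disjoint_setI0 // cards0 subn0.
  have [||B1 B2 defB dB noB|f Hf] := IHn B.
  - by rewrite -ltnS (leq_trans _ leAn) // ltnS cA -addn1 leq_add2l card_gt0.
  - by apply: P4_free_subset P4; rewrite defA subsetUl.
  - apply: (evenA B1 (B2 :|: C)); first by rewrite defA defB setUA.
      rewrite disjoint_sym disjoints_subset subUset -!disjoints_subset disjoint_sym dB.
      by rewrite disjoint_sym (disjointWl _ dBC) // defB subsetUl.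
    move=> x y xB1; rewrite inE => /orP[]; first exact: noB.
    by apply: noBC; rewrite defB inE xB1.
  have [||C1 C2 defC dC noC|g Hg] := IHn C.
  - by rewrite -ltnS (leq_trans _ leAn) // ltnS cA -add1n leq_add2r card_gt0.
  - by apply: P4_free_subset P4; rewrite defA subsetUr.
  - apply: (evenA C1 (C2 :|: B)); first by rewrite defA defC setUC setUA.
      rewrite disjoint_sym disjoints_subset subUset -!disjoints_subset disjoint_sym dC.
      by rewrite (disjointWr _ dBC) // defC subsetUl.
    move=> x y xC1; rewrite inE => /orP[]; first exact: noC.
    by move=> yB; rewrite symE noBC // defC inE xC1.
  (* Both sides reuse the same three colours, as no edge runs between them. *)
  exists (fun u => if u \in B then f u else g u); rewrite defA.
  apply: odd_coloringU => //.
  - by move=> x y xB yC; rewrite (negbTE (noBC x y xB yC)).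
  - by apply: eq_odd_coloring Hf => x y xB yB; rewrite xB yB.
  by apply: eq_odd_coloring Hg => x y xC yC; rewrite !(disjointFl dBC).
rewrite defA; apply: join_coloring => //; last by rewrite -defA.
by move=> x y xB yC; have := noBC x y xB yC; rewrite negbK.
Qed.

Variable G : sgraph.
Implicit Type P : {set {set G}}.

Lemma cograph_P4_free : cograph G -> P4_free (@adj G) [set: G].
Proof.
move=> cogG a b c d _ uniq_s; apply/negP => /and5P[ab bc cd ac /andP[bd ad]].
apply: cogG; exists (fun i : 'I_4 => nth a [:: a; b; c; d] i); split.
  move=> i j /eqP; rewrite nth_uniq //= => /eqP; exact: val_inj.
rewrite /path_graph /= /path_adj.
have [ba cb dc] : [/\ adj b a, adj c b & adj d c] by split; rewrite adj_sym.
have [ca db da] : [/\ ~~ adj c a, ~~ adj d b & ~~ adj d a] by split; rewrite adj_sym.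
by do 2![case=> [[|[|[|[|?]]]] ?] //=]; rewrite ?adj_irrefl //; apply/negbTE.
Qed.

(** A set that no edge leaves is a union of components: it is partitioned by connectivity, and each
    class is a full component of [G]. *)
Lemma even_components_closed (B : {set G}) : even_components G ->
  {in B & ~: B, forall x y, ~~ adj x y} -> ~~ odd #|B|.
Proof.
move=> evenG closedB.
have clB x y : connect (@adj G) x y -> x \in B -> y \in B.
  move=> /connectP[p]; elim: p x => [|z p IHp] x /=; first by move=> _ ->.
  move=> /andP[xz pz] eqy xB; apply: IHp pz eqy _.
  by apply: contraLR xz => zB; apply: closedB; rewrite // inE.
have symG : connect_sym (@adj G) by apply: sym_connect_sym; apply: adj_sym.
have eqR : {in B & &, equivalence_rel (connect (@adj G))}.
  by move=> x y z _ _ _; split=> [|xy]; [apply: connect0 | apply: same_connect].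
rewrite (card_partition (equivalence_partitionP eqR)).
rewrite (big_morph odd oddD (erefl : odd 0 = false)) big1 // => C /imsetP[x xB ->].
apply/negbTE/evenG/imsetP; exists x => //; apply/setP=> y; rewrite !inE /=.
by apply: andb_idl => xy; apply: clB xy xB.
Qed.

Lemma odd_graph_induced (S : {set G}) :
  odd_graph (induced S) = [forall x in S, odd #|[set u in S | adj x u]|].
Proof.
have degE (v : induced S) : degree v = #|[set u in S | adj (val v) u]|.
  rewrite /degree -(card_imset (mem [set w | adj v w]) val_inj); apply: eq_card => u; rewrite !inE.
  apply/imsetP/andP => [[w]|[uS vu]]; first by rewrite inE => vw ->; split=> //; apply: valP.
  by exists (Sub u uS); rewrite ?inE.
apply/forallP/forall_inP => [oddS x xS|oddS v]; last by rewrite degE oddS ?(valP v).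
by have := oddS (Sub x xS); rewrite degE.
Qed.

(** Taking the block of a vertex as its colour makes the colouring lemmas available for
    partitions. *)
Lemma odd_partitionP P :
  reflect (partition P [set: G] /\ odd_coloring (@adj G) [set: G] (pblock P))
          (odd_partition P).
Proof.
apply: (iffP andP) => -[partP oddP]; split=> //.
  move=> x _; rewrite -odd_card_xor.
  have [/eqP covP tiP _] := and3P partP.
  have Px : pblock P x \in P by rewrite pblock_mem ?covP.
  have := forall_inP oddP _ Px; rewrite odd_graph_induced => /forall_inP/(_ x).
  rewrite mem_pblock covP inE => /(_ isT); congr (odd _); apply: eq_card => u.
  by rewrite !inE eq_sym eq_pblock ?covP // andbC.
apply/forall_inP => S PS; rewrite odd_graph_induced; apply/forall_inP => x xS.
have [/eqP covP tiP _] := and3P partP.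
have := oddP x (in_setT x); rewrite -odd_card_xor; congr (odd _).
apply: eq_card => u.
by rewrite !inE /= eq_sym eq_pblock ?covP // (def_pblock tiP PS xS) andbC.
Qed.

Lemma odd_coloring_partition (C : finType) (f : G -> C) :
  odd_coloring (@adj G) [set: G] f ->
  exists2 P : {set {set G}}, odd_partition P & #|P| <= #|C|.
Proof.
move=> oddf; have partP := preim_partitionP f [set: G].
exists (preim_partition f [set: G]); last first.
  pose Q := [set [set y | c == f y] | c : C].
  apply: leq_trans (leq_imset_card (fun c => [set y | c == f y]) C).
  apply: subset_leq_card; apply/subsetP=> S /imsetP[x _ ->].
  by apply/imsetP; exists (f x) => //; apply/setP=> y; rewrite !inE.
apply/odd_partitionP; split=> //; apply: eq_odd_coloring oddf => x y _ _.
have [/eqP covP tiP _] := and3P partP.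
rewrite eq_pblock ?covP // pblock_equivalence_partition ?inE //.
by move=> a b c _ _ _; split=> // /eqP->.
Qed.

Lemma odd_chromatic_number_le P : odd_partition P ->
  exists2 k, is_odd_chromatic_number G k & k <= #|P|.
Proof.
move=> oddP.
pose has_part k := [exists Q : {set {set G}}, odd_partition Q && (#|Q| == k)].
have exk : exists k, has_part k by exists #|P|; apply/existsP; exists P; rewrite oddP /=.
have [k /exists_inP[Q oddQ /eqP cQ] mink] := ex_minnP exk.
have mink' (R : {set {set G}}) : odd_partition R -> k <= #|R|.
  by move=> oddR; apply: mink; apply/exists_inP; exists R.
by exists k; [split; [exists Q|] | apply: mink'].
Qed.

Lemma cograph_odd_chromatic_number : cograph G -> even_components G ->
  exists2 k, is_odd_chromatic_number G k & k <= 3.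
Proof.
move=> cogG evenG.
have [B C defG dBC noBC|f] :=
    P4_free_odd_coloring (@adj_sym G) (@adj_irrefl G) (cograph_P4_free cogG).
  apply: even_components_closed => // x y xB; rewrite inE => yB; apply: noBC => //.
  by have := in_setT y; rewrite defG inE (negbTE yB).
move=> /odd_coloring_partition[P /odd_chromatic_number_le[k chik lekP]].
by rewrite card_ord => leP3; exists k => //; apply: leq_trans leP3.
Qed.

End Cographs.

(** * Tightness: the octahedron *)

Section Octahedron.

Definition octahedron_adj : rel ('I_3 * bool) := fun x y => x.1 != y.1.

Fact octahedron_adj_sym : symmetric octahedron_adj.
Proof. by move=> x y; rewrite /octahedron_adj eq_sym. Qed.

Fact octahedron_adj_irrefl : irreflexive octahedron_adj.
Proof. by move=> x; rewrite /octahedron_adj eqxx. Qed.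

Definition octahedron : sgraph := SGraph octahedron_adj_sym octahedron_adj_irrefl.

(** Non-adjacency means lying in the same part, hence is transitive; on a path 0, 1, 2, 3 it is not,
    as 0 is non-adjacent to the adjacent vertices 2 and 3. *)
Lemma octahedron_cograph : cograph octahedron.
Proof.
move=> [f [_ fE]].
pose i k : 'I_4 := inord k.
have := fE (i 0) (i 2); have := fE (i 0) (i 3); have := fE (i 2) (i 3).
rewrite /= /path_adj /i !inordK //= /octahedron_adj => h23.
by move=> /negbFE/eqP h03 /negbFE/eqP h02; move: h23; rewrite -h03 h02 eqxx.
Qed.

Lemma octahedron_even_components : even_components octahedron.
Proof.
have conn (x y : octahedron) : connect (@adj octahedron) x y.
  have [eqxy|] := boolP (x.1 == y.1); last exact: connect1.
  (* Two vertices of one part have a common neighbour in any other part [k]. *)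
  have [k neq_k] : exists k : 'I_3, k != x.1.
    by case: (eqVneq x.1 ord0) => [->|x0]; [exists ord_max | exists ord0; rewrite eq_sym].
  apply: (@connect_trans _ _ ((k, true) : octahedron)); apply: connect1.
    by rewrite /= /octahedron_adj eq_sym.
  by rewrite /= /octahedron_adj -(eqP eqxy).
move=> C /imsetP[x _ ->].
rewrite (_ : [set _ in _ | _] = [set: octahedron]); last first.
  by apply/setP=> y; rewrite !inE conn.
by rewrite cardsT card_prod card_ord card_bool.
Qed.

Lemma octahedron_odd_partition (P : {set {set octahedron}}) :
  odd_partition P -> 3 <= #|P|.
Proof.
move=> /odd_partitionP[partP oddP]; rewrite ltnNge; apply/negP => leP2.
have [/eqP covP tiP _] := and3P partP.
(* With at most one block besides [S], membership in [S] already determines the partition, which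
   thus becomes a two-colouring [s]. *)
pose S := pblock P ((ord0, true) : octahedron).
have PS : S \in P by rewrite pblock_mem ?covP.
have /card_le1_eqP eqP1 : #|P :\ S| <= 1 by move: leP2; rewrite (cardsD1 S) PS.
have Pb u : pblock P u != S -> pblock P u \in P :\ S.
  by move=> uS; rewrite !inE uS pblock_mem ?covP.
have odds : odd_coloring (@adj octahedron) [set: octahedron] (fun u => pblock P u == S).
  apply: eq_odd_coloring oddP => u v _ _.
  have [->|uS] := eqVneq (pblock P u) S; first by rewrite eq_sym; case: eqP.
  have [->|vS] := eqVneq (pblock P v) S; first by rewrite (negbTE uS).
  by rewrite (eqP1 _ _ (Pb u uS) (Pb v vS)) !eqxx.
move: odds; move: (fun u : octahedron => pblock P u == S) => s odds.
(* One vertex from each part gives the three contradictory parity conditions. *)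
have oddi (i : 'I_3) : \big[addb/false]_(j < 3) \big[addb/false]_(b : bool)
    ((i != j) && (s (j, b) == s (i, true))).
  rewrite (pair_bigA _ (fun j b => (i != j) && (s (j, b) == s (i, true)))) /=.
  have := odds (i, true) (in_setT _); congr is_true.
  by apply: eq_big => [u|[j b] _]; rewrite ?inE.
have := oddi ord0; have := oddi (lift ord0 ord0); have := oddi (lift ord0 (lift ord0 ord0)).
rewrite !big_ord_recl !big_ord0 !big_bool /=.
(* Exhaustive check over the colours of the six vertices. *)
by do 6!case: (s _).
Qed.

Lemma octahedron_odd_chromatic_number : is_odd_chromatic_number octahedron 3.
Proof.
have [k chik] :=
  cograph_odd_chromatic_number octahedron_cograph octahedron_even_components.
rewrite leq_eqVlt => /predU1P[<- //|]; have [[P /octahedron_odd_partition leP <-] _] := chik.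
by rewrite ltnNge leP.
Qed.

End Octahedron.

Theorem corollary1 :
  (forall G : sgraph, cograph G -> even_components G ->
     exists2 k : nat, is_odd_chromatic_number G k & k <= 3) /\
  (exists G : sgraph,
     [/\ cograph G, even_components G & is_odd_chromatic_number G 3]).
Proof.
split; first exact: cograph_odd_chromatic_number.
exists octahedron; split.
- exact: octahedron_cograph.
- exact: octahedron_even_components.
- exact: octahedron_odd_chromatic_number.
Qed.
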